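(* Let $L$ be a valid lattice and $t$ a tiling of $\mathbb{T}_L$ with flux $\varphi_t\in\mathscr{F}(L)$. Then $t$ admits no flips if and only if $\varphi_t\in\partial Q$, where $Q=\{(x,y)\in\mathbb{R}^2: |x|+|y|\le\frac12\}$ (i.e. if and only if $\varphi_t=(x,y)$ satisfies $|x|+|y|=\frac12$).
   Context: The unit square $[i,i+1]\times[j,j+1]$ ($i,j\in\mathbb{Z}$) is black if $i+j$ is even and white otherwise. A domino is the union of two unit squares sharing a side; a tiling of $\mathbb{Z}^2$ is a set of dominoes with pairwise disjoint interiors covering $\mathbb{R}^2$. Let $\mathscr{E}=2\mathbb{Z}^2$, $\mathscr{O}=2\mathbb{Z}^2+(1,1)$. A valid lattice is a subgroup $L\subset\mathbb{Z}^2$ generated by two linearly independent vectors in $\mathscr{E}\sqcup\mathscr{O}$. A tiling of $\mathbb{T}_L=\mathbb{R}^2/L$ is identified with an $L$-periodic tiling of $\mathbb{Z}^2$; it admits a flip if two parallel dominoes of the periodic tiling together form a $2\times2$ square. Height functions: each unit edge between neighboring points of $\mathbb{Z}^2$ is oriented so that the boundary of every black square is oriented clockwise. The height function $h_t:\mathbb{Z}^2\to\mathbb{Z}$ of a tiling $t$ satisfies $h_t(0)=0$ and, for every edge oriented from $u$ to $w$: $h_t(w)=h_t(u)+1$ if the edge is not the common side of the two squares of a domino of $t$, and $h_t(w)=h_t(u)-3$ otherwise. Flux: for a tiling $t$ of $\mathbb{T}_L$, $h_t(u+v)-h_t(u)$ depends only on $v\in L$ and is additive in $v$; the flux of $t$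 is the unique $\varphi_t\in\mathbb{R}^2$ with $4\langle\varphi_t,v\rangle=h_t(u+v)-h_t(u)$ for all $v\in L$, $u\in\mathbb{Z}^2$. $\mathscr{F}(L)$ is the set of fluxes of all tilings of $\mathbb{T}_L$; it is contained in $Q$. *)

(* Defs.v *)
From mathcomp Require Import all_boot all_order all_algebra.
From mathcomp Require Import all_classical all_reals all_analysis.
Set Implicit Arguments.
Unset Strict Implicit.
Unset Printing Implicit Defensive.
Import Order.TTheory GRing.Theory Num.Theory.
Import numFieldNormedType.Exports.
Local Open Scope classical_set_scope.
Local Open Scope ring_scope.

(* points of Z^2 *)
Definition latpt : Type := (int * int)%type.

(* [s.1, s.1 + n] x [s.2, s.2 + n] *)
Definition box (R : realType) (n : nat) (s : latpt) : set (R * R) :=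
  [set z | (s.1%:~R <= z.1 <= s.1%:~R + n%:R) /\
           (s.2%:~R <= z.2 <= s.2%:~R + n%:R)].
Arguments box : clear implicits.

(* A unit square is designated by its lower left corner. *)
Definition unit_square (R : realType) (s : latpt) : set (R * R) := box R 1 s.
Arguments unit_square : clear implicits.

Definition black (s : latpt) : Prop := (2 %| s.1 + s.2)%Z.

Variant direction := Horizontal | Vertical.

Definition step (a : direction) : latpt :=
  match a with Horizontal => (1, 0) | Vertical => (0, 1) end.

(* The domino made of the unit squares at corner and corner + step dir. *)
Record domino := Domino { dir : direction; corner : latpt }.

Definition region (R : realType) (d : domino) : set (R * R) :=
  unit_square R (corner d) `|` unit_square R (corner d + step (dir d)).
Arguments region : clear implicits.

(* u and w are the endpoints of the common side of the two squares of d; that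
   side runs from corner + (1, 0) or corner + (0, 1), according to the
   direction of d, to corner + (1, 1). *)
Definition is_common_side (d : domino) (u w : latpt) : Prop :=
  let p := corner d + step (dir d) in
  let q := corner d + (1, 1) in
  (u = p /\ w = q) \/ (u = q /\ w = p).

Definition tiling (R : realType) (t : set domino) : Prop :=
  trivIset t (fun d => interior (region R d)) /\
  \bigcup_(d in t) region R d = [set: R * R].

Definition lattice_E : set latpt :=
  [set v | exists x y : int, v = (2 * x, 2 * y)].

Definition lattice_O : set latpt :=
  [set v | exists x y : int, v = (2 * x + 1, 2 * y + 1)].

Definition lin_indep (a b : latpt) : Prop :=
  forall m n : int, a *~ m + b *~ n = 0 -> m = 0 /\ n = 0.

Definition valid_lattice (L : set latpt) : Prop :=
  exists a b : latpt,
    [/\ (lattice_E `|` lattice_O) a, (lattice_E `|` lattice_O) b,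
        lin_indep a b
      & L = [set v | exists m n : int, v = a *~ m + b *~ n]].

Definition translate (v : latpt) (d : domino) : domino :=
  Domino (dir d) (corner d + v).

Definition torus_tiling (R : realType) (L : set latpt) (t : set domino) : Prop :=
  tiling R t /\ forall v d, L v -> t d -> t (translate v d).

Definition admits_flip (R : realType) (t : set domino) : Prop :=
  exists d1 d2 : domino,
    [/\ t d1, t d2, dir d1 = dir d2
      & exists s : latpt, region R d1 `|` region R d2 = box R 2 s].

(* u -> w is a side of the square at s, traversed clockwise. *)
Definition clockwise_side (s u w : latpt) : Prop :=
  [\/ u = s /\ w = s + (0, 1),
      u = s + (0, 1) /\ w = s + (1, 1),
      u = s + (1, 1) /\ w = s + (1, 0)
    | u = s + (1, 0) /\ w = s].

(* Each edge is a side of exactly one black square, so this orients it. *)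
Definition oriented_edge (u w : latpt) : Prop :=
  exists s, black s /\ clockwise_side s u w.

Definition height_function (t : set domino) (h : latpt -> int) : Prop :=
  h 0 = 0 /\
  forall u w, oriented_edge u w ->
    (~ (exists2 d, t d & is_common_side d u w) -> h w = h u + 1) /\
    ((exists2 d, t d & is_common_side d u w) -> h w = h u - 3).

(* phi is the flux of the tiling t of the torus R^2 / L; a tiling has exactly
   one height function h. *)
Definition is_flux (R : realType) (L : set latpt) (t : set domino)
    (phi : R * R) : Prop :=
  exists2 h, height_function t h &
    forall u v : latpt, L v ->
      4 * (phi.1 * v.1%:~R + phi.2 * v.2%:~R) = (h (u + v) - h u)%:~R.

Definition Q (R : realType) : set (R * R) :=
  [set z | `|z.1| + `|z.2| <= 1 / 2].
Arguments Q : clear implicits.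

Definition boundary (T : topologicalType) (A : set T) : set T :=
  closure A `\` interior A.

(* Main.v *)
Require Import Defs.
From mathcomp Require Import all_boot all_order all_algebra.
From mathcomp Require Import all_classical all_reals all_analysis.
From mathcomp Require Import zify ring lra.
Import Order.TTheory GRing.Theory Num.Theory.
Import numFieldNormedType.Exports.
Local Open Scope classical_set_scope.
Local Open Scope ring_scope.

(* A point x + y even has its vertical edges outgoing and its horizontal edges
   incoming, and conversely for x + y odd.  Two consecutive edges around a corner
   therefore have the same orientation along the path, so the height changes by
   at most 2 along a diagonal step (+-1, +-1).  As L contains multiples of the
   four diagonal vectors, |x| + |y| <= 1/2.  At the centre of a flip the height is
   extremal among the four diagonal neighbours, so no diagonal through it is
   monotone and the inequality is strict.  Conversely, a point whose two outgoing
   edges are both crossed by dominoes is the centre of a flip; without flips one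
   can thus follow uncrossed outgoing edges forever, gaining 2 at each diagonal
   step, and two positions congruent mod L give v in L with
   4 <phi, v> = 2 k and |v.1|, |v.2| <= k, whence |x| + |y| >= 1/2. *)

(** * Orientation of edges and crossed edges *)

Definition crossed (t : set domino) (u w : latpt) : Prop :=
  exists2 d, t d & is_common_side d u w.

Definition sign (e : int) : Prop := e = 1 \/ e = -1.

(** A clockwise boundary keeps its square on the right, so the witness is the square to the right of
    the directed edge; parity makes it black. The same choice works in [odd_edge]. *)
Lemma even_edge (x y e : int) : sign e -> (2 %| x + y)%Z ->
  oriented_edge (x, y) (x, y + e).
Proof.
move=> [->|->] xy.
  exists (x, y); split => //; apply: Or41; split => //.
  by congr pair => /=; ring.
exists (x - 1, y - 1); split; first by rewrite /black /=; lia.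
by apply: Or43; split; congr pair => /=; ring.
Qed.

Lemma odd_edge (x y e : int) : sign e -> ~~ (2 %| x + y)%Z ->
  oriented_edge (x, y) (x + e, y).
Proof.
move=> [->|->] xy.
  exists (x, y - 1); split; first by rewrite /black /=; lia.
  by apply: Or42; split; congr pair => /=; ring.
exists (x - 1, y); split; first by rewrite /black /=; lia.
by apply: Or44; split; congr pair => /=; ring.
Qed.

Lemma crossedC (t : set domino) (u w : latpt) : crossed t u w -> crossed t w u.
Proof. by move=> [d td [][-> ->]]; exists d => //; [right|left]. Qed.

Lemma signN (e : int) : sign e -> sign (- e).
Proof. by case=> ->; [right|left]. Qed.

Definition hgt (h : latpt -> int) (x y : int) : int := h (x, y).

(** * Height along diagonals *)

Section Height.
Variables (t : set domino) (h : latpt -> int).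
Hypothesis hh : height_function t h.

Lemma height_edge (u w : latpt) : oriented_edge u w ->
  (h w = h u + 1) \/ (crossed t u w /\ h w = h u - 3).
Proof.
case: hh => _ H /H[free cross].
by have [c|/free] := pselect (crossed t u w); [right; split=> //; exact: cross|left].
Qed.

Lemma height_edge_crossed (u w : latpt) :
  oriented_edge u w -> crossed t u w -> h w = h u - 3.
Proof. by case: hh => _ H /H[_]; apply. Qed.

Lemma height_even_le (x y e : int) : sign e -> (2 %| x + y)%Z ->
  hgt h x (y + e) <= hgt h x y + 1.
Proof.
move=> se xy.
suff : hgt h x (y + e) = hgt h x y + 1 \/ hgt h x (y + e) = hgt h x y - 3 by lia.
by have [|[_]] := height_edge _ _ (even_edge _ _ _ se xy); [left|right].
Qed.

Lemma height_odd_le (x y e : int) : sign e -> ~~ (2 %| x + y)%Z ->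
  hgt h (x + e) y <= hgt h x y + 1.
Proof.
move=> se xy.
suff : hgt h (x + e) y = hgt h x y + 1 \/ hgt h (x + e) y = hgt h x y - 3 by lia.
by have [|[_]] := height_edge _ _ (odd_edge _ _ _ se xy); [left|right].
Qed.

(** The corner is turned so that both edges are outgoing: vertical then horizontal from an even
    point, horizontal then vertical from an odd one. Each edge raises the height by at most 1. *)
Lemma height_diag_le (x y a b : int) : sign a -> sign b ->
  hgt h (x + a) (y + b) <= hgt h x y + 2.
Proof.
move=> sa sb; have [xy|xy] := boolP (2 %| x + y)%Z.
  have := height_even_le _ _ _ sb xy.
  have xyb : ~~ (2 %| x + (y + b))%Z by case: sb; lia.
  by have := height_odd_le _ _ _ sa xyb; lia.
have := height_odd_le _ _ _ sa xy.
have xya : (2 %| x + a + y)%Z by case: sa; lia.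
by have := height_even_le _ _ _ sb xya; lia.
Qed.

Lemma height_diag_iter_le (x y a b : int) (n : nat) : sign a -> sign b ->
  hgt h (x + a *+ n) (y + b *+ n) <= hgt h x y + 2 * n%:Z.
Proof.
move=> sa sb; elim: n => [|n IH]; first by rewrite !mulr0n !addr0; lia.
have -> : x + a *+ n.+1 = x + a *+ n + a by rewrite mulrSr addrA.
have -> : y + b *+ n.+1 = y + b *+ n + b by rewrite mulrSr addrA.
by have := height_diag_le (x + a *+ n) (y + b *+ n) _ _ sa sb; lia.
Qed.

Definition diag_extremum (x y : int) : Prop :=
  (forall a b, sign a -> sign b -> hgt h (x + a) (y + b) <= hgt h x y - 2) \/
  (forall a b, sign a -> sign b -> hgt h x y + 2 <= hgt h (x + a) (y + b)).

(** At an even point both vertical edges go out and lose 3, and the next edge regains at most 1: a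
    maximum. At an odd point they come in, so the vertical neighbours are 3 higher, and a diagonal
    neighbour is at most 1 below them: a minimum. *)
Lemma vertical_crossing_extremum (x y : int) :
  (forall e, sign e -> crossed t (x, y) (x, y + e)) -> diag_extremum x y.
Proof.
move=> cr; have [xy|xy] := boolP (2 %| x + y)%Z; [left|right] => a b sa sb.
  have : hgt h x (y + b) = hgt h x y - 3.
    by apply: height_edge_crossed; [exact: even_edge|exact: cr].
  have xyb : ~~ (2 %| x + (y + b))%Z by case: sb; lia.
  by have := height_odd_le _ _ _ sa xyb; lia.
have xyb : (2 %| x + (y + b))%Z by case: sb; lia.
have : hgt h x y = hgt h x (y + b) - 3.
  have := even_edge _ _ _ (signN _ sb) xyb; rewrite addrK => e1.
  exact: height_edge_crossed e1 (crossedC _ _ _ (cr _ sb)).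
have xyab : ~~ (2 %| x + a + (y + b))%Z by case: sa; lia.
by have := height_odd_le _ _ _ (signN _ sa) xyab; rewrite addrK; lia.
Qed.

Lemma horizontal_crossing_extremum (x y : int) :
  (forall e, sign e -> crossed t (x, y) (x + e, y)) -> diag_extremum x y.
Proof.
move=> cr; have [xy|xy] := boolP (2 %| x + y)%Z; [right|left] => a b sa sb.
  have xya : ~~ (2 %| x + a + y)%Z by case: sa; lia.
  have : hgt h x y = hgt h (x + a) y - 3.
    have := odd_edge _ _ _ (signN _ sa) xya; rewrite addrK => e1.
    exact: height_edge_crossed e1 (crossedC _ _ _ (cr _ sa)).
  have xyab : (2 %| x + a + (y + b))%Z by case: sb; lia.
  by have := height_even_le _ _ _ (signN _ sb) xyab; rewrite addrK; lia.
have : hgt h (x + a) y = hgt h x y - 3.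
  by apply: height_edge_crossed; [exact: odd_edge|exact: cr].
have xya : (2 %| x + a + y)%Z by case: sa; lia.
by have := height_even_le _ _ _ sb xya; lia.
Qed.

(** The path reaches the extremum after one step. The step out of a maximum, or into a minimum,
    loses at least 2, so the first two steps gain nothing in total; [2 <= n] ensures that both are
    taken. *)
Lemma height_extremum_lt (x y a b : int) (n : nat) :
  diag_extremum x y -> sign a -> sign b -> (2 <= n)%N ->
  hgt h (x - a + a *+ n) (y - b + b *+ n) < hgt h (x - a) (y - b) + 2 * n%:Z.
Proof.
move=> ext sa sb; case: n => [|[|n]] // _.
have -> : x - a + a *+ n.+2 = x + a + a *+ n by rewrite !mulrSr; ring.
have -> : y - b + b *+ n.+2 = y + b + b *+ n by rewrite !mulrSr; ring.
have := height_diag_iter_le (x + a) (y + b) _ _ n sa sb.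
have := height_diag_le (x - a) (y - b) _ _ sa sb.
have := height_diag_le x y _ _ sa sb; rewrite !subrK.
have snb := signN _ sb; have sna := signN _ sa.
by case: ext => ext; [have := ext _ _ sa sb|have := ext _ _ sna snb]; lia.
Qed.

End Height.

(** * Regions of dominoes and the centre of a flip *)

Section Geometry.
Variable R : realType.

Lemma region_horizontalE (x y : int) :
  region R (Domino Horizontal (x, y)) =
  [set z | (x%:~R <= z.1 <= x%:~R + 2) /\ (y%:~R <= z.2 <= y%:~R + 1)].
Proof.
have -> : region R (Domino Horizontal (x, y)) = box R 1 (x, y) `|` box R 1 (x + 1, y).
  rewrite /region /unit_square; congr (_ `|` box R 1 _).
  by congr pair; rewrite /= addr0.
apply/seteqP; split => -[p q].
  by move=> [] [] /=; rewrite ?intrD => /andP[? ?] /andP[? ?];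
    split; apply/andP; split; lra.
move=> [] /= /andP[? ?] /andP[? ?].
by have [?|?] := lerP p (x%:~R + 1); [left|right];
  split; apply/andP; split; rewrite /= ?intrD; lra.
Qed.

Lemma region_verticalE (x y : int) :
  region R (Domino Vertical (x, y)) =
  [set z | (x%:~R <= z.1 <= x%:~R + 1) /\ (y%:~R <= z.2 <= y%:~R + 2)].
Proof.
have -> : region R (Domino Vertical (x, y)) = box R 1 (x, y) `|` box R 1 (x, y + 1).
  rewrite /region /unit_square; congr (_ `|` box R 1 _).
  by congr pair; rewrite /= addr0.
apply/seteqP; split => -[p q].
  by move=> [] [] /=; rewrite ?intrD => /andP[? ?] /andP[? ?];
    split; apply/andP; split; lra.
move=> [] /= /andP[? ?] /andP[? ?].
by have [?|?] := lerP q (y%:~R + 1); [left|right];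
  split; apply/andP; split; rewrite /= ?intrD; lra.
Qed.

Lemma horizontal_pairE (x y : int) :
  region R (Domino Horizontal (x, y)) `|` region R (Domino Horizontal (x, y + 1))
  = box R 2 (x, y).
Proof.
rewrite !region_horizontalE; apply/seteqP; split => -[p q] /=.
  by rewrite /box /= intrD => -[] [] /andP[? ?] /andP[? ?];
    split; apply/andP; split; lra.
rewrite /box /= intrD => -[] /andP[? ?] /andP[? ?].
by have [px|px] := lerP q (y%:~R + 1); [left|right];
  split; apply/andP; split; lra.
Qed.

Lemma vertical_pairE (x y : int) :
  region R (Domino Vertical (x, y)) `|` region R (Domino Vertical (x + 1, y))
  = box R 2 (x, y).
Proof.
rewrite !region_verticalE; apply/seteqP; split => -[p q] /=.
  by rewrite /box /= intrD => -[] [] /andP[? ?] /andP[? ?];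
    split; apply/andP; split; lra.
rewrite /box /= intrD => -[] /andP[? ?] /andP[? ?].
by have [px|px] := lerP p (x%:~R + 1); [left|right];
  split; apply/andP; split; lra.
Qed.

(** Testing regions at integer points turns an equality of plane sets into integer inequalities,
    which suffices to locate the two dominoes of a flip. *)
Lemma lattice_in_box (n : nat) (x y p q : int) :
  box R n (x, y) (p%:~R, q%:~R) <-> (x <= p <= x + n%:Z) /\ (y <= q <= y + n%:Z).
Proof. by rewrite /box /= !(pmulrn _ n) -!intrD !ler_int. Qed.

Lemma lattice_in_horizontal (x y p q : int) :
  region R (Domino Horizontal (x, y)) (p%:~R, q%:~R) <->
  (x <= p <= x + 2) /\ (y <= q <= y + 1).
Proof. by rewrite region_horizontalE /= -!(intrD _ _ 1) -!(intrD _ _ 2) !ler_int. Qed.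

Lemma lattice_in_vertical (x y p q : int) :
  region R (Domino Vertical (x, y)) (p%:~R, q%:~R) <->
  (x <= p <= x + 1) /\ (y <= q <= y + 2).
Proof. by rewrite region_verticalE /= -!(intrD _ _ 1) -!(intrD _ _ 2) !ler_int. Qed.

Lemma horizontal_pair_corners (x y x1 y1 x2 y2 : int) :
  region R (Domino Horizontal (x1, y1)) `|` region R (Domino Horizontal (x2, y2))
    = box R 2 (x, y) ->
  [/\ x1 = x, x2 = x & (y1 = y /\ y2 = y + 1) \/ (y1 = y + 1 /\ y2 = y)].
Proof.
move=> E; have {}E p q : ((x1 <= p <= x1 + 2) /\ (y1 <= q <= y1 + 1)) \/
    ((x2 <= p <= x2 + 2) /\ (y2 <= q <= y2 + 1)) <->
    (x <= p <= x + 2) /\ (y <= q <= y + 2).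
  by rewrite -!lattice_in_horizontal -(lattice_in_box 2) -E.
(* Opposite corners of each domino must lie in the box, which fixes [x1] and [x2] and leaves two
   values for [y1] and [y2]. Covering the two left corners of the box forces these to differ. *)
have := E x1 y1; have := E (x1 + 2) (y1 + 1).
have := E x2 y2; have := E (x2 + 2) (y2 + 1).
have := E x y; have := E x (y + 2).
by move=> *; split; lia.
Qed.

Lemma vertical_pair_corners (x y x1 y1 x2 y2 : int) :
  region R (Domino Vertical (x1, y1)) `|` region R (Domino Vertical (x2, y2))
    = box R 2 (x, y) ->
  [/\ y1 = y, y2 = y & (x1 = x /\ x2 = x + 1) \/ (x1 = x + 1 /\ x2 = x)].
Proof.
move=> E; have {}E p q : ((x1 <= p <= x1 + 1) /\ (y1 <= q <= y1 + 2)) \/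
    ((x2 <= p <= x2 + 1) /\ (y2 <= q <= y2 + 2)) <->
    (x <= p <= x + 2) /\ (y <= q <= y + 2).
  by rewrite -!lattice_in_vertical -(lattice_in_box 2) -E.
have := E x1 y1; have := E (x1 + 1) (y1 + 2).
have := E x2 y2; have := E (x2 + 1) (y2 + 2).
have := E x y; have := E (x + 2) y.
by move=> *; split; lia.
Qed.

Lemma crossed_up (t : set domino) (x y : int) :
  crossed t (x, y) (x, y + 1) -> t (Domino Horizontal (x - 1, y)).
Proof.
move=> [[[] [p q]] td [] [[E1 E2] [E3 E4]]]; try by exfalso; lia.
have -> : x - 1 = p by lia.
by have -> : y = q by lia.
Qed.

Lemma crossed_right (t : set domino) (x y : int) :
  crossed t (x, y) (x + 1, y) -> t (Domino Vertical (x, y - 1)).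
Proof.
move=> [[[] [p q]] td [] [[E1 E2] [E3 E4]]]; try by exfalso; lia.
have -> : x = p by lia.
by have -> : y - 1 = q by lia.
Qed.

Lemma vertical_crossing_flip (t : set domino) (x y : int) :
  (forall e, sign e -> crossed t (x, y) (x, y + e)) -> admits_flip R t.
Proof.
move=> cr; have up := crossed_up _ _ _ (cr 1 (or_introl erefl)).
(* The lower edge is reversed so that it points up from [y - 1], the form [crossed_up] expects. *)
have := crossedC _ _ _ (cr (- 1) (or_intror erefl)).
rewrite -{2}[y](subrK 1) => /crossed_up down.
exists (Domino Horizontal (x - 1, y - 1)), (Domino Horizontal (x - 1, y)).
by split => //; exists (x - 1, y - 1); rewrite -horizontal_pairE subrK.
Qed.

Lemma horizontal_crossing_flip (t : set domino) (x y : int) :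
  (forall e, sign e -> crossed t (x, y) (x + e, y)) -> admits_flip R t.
Proof.
move=> cr; have right := crossed_right _ _ _ (cr 1 (or_introl erefl)).
have := crossedC _ _ _ (cr (- 1) (or_intror erefl)).
rewrite -{2}[x](subrK 1) => /crossed_right left.
exists (Domino Vertical (x - 1, y - 1)), (Domino Vertical (x, y - 1)).
by split => //; exists (x - 1, y - 1); rewrite -vertical_pairE subrK.
Qed.

Lemma flip_extremum (t : set domino) (h : latpt -> int) :
  height_function t h -> admits_flip R t -> exists x y, diag_extremum h x y.
Proof.
move=> hh [[[] [x1 y1]] [[[] [x2 y2]] [/= t1 t2 // _ [[x y] E]]]].
  (* The extremum is the centre of the square, where the common sides of the two dominoes meet. *)
  exists (x + 1), (y + 1); apply: vertical_crossing_extremum hh _ _ _.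
  have [? ? ys] := horizontal_pair_corners _ _ _ _ _ _ E; subst x1 x2.
  have [td tu] : t (Domino Horizontal (x, y)) /\ t (Domino Horizontal (x, y + 1)).
    by case: ys => -[? ?]; subst.
  move=> e [->|->].
    by exists (Domino Horizontal (x, y + 1)) => //; left; split; congr pair => /=; ring.
  by exists (Domino Horizontal (x, y)) => //; right; split; congr pair => /=; ring.
exists (x + 1), (y + 1); apply: horizontal_crossing_extremum hh _ _ _.
have [? ? xs] := vertical_pair_corners _ _ _ _ _ _ E; subst y1 y2.
have [td tu] : t (Domino Vertical (x, y)) /\ t (Domino Vertical (x + 1, y)).
  by case: xs => -[? ?]; subst.
move=> e [->|->].
  by exists (Domino Vertical (x + 1, y)) => //; left; split; congr pair => /=; ring.
by exists (Domino Vertical (x, y)) => //; right; split; congr pair => /=; ring.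
Qed.

(** * Ascending paths in tilings without flips *)

Lemma noflip_even (t : set domino) (h : latpt -> int) (x y : int) :
  height_function t h -> ~ admits_flip R t -> (2 %| x + y)%Z ->
  exists2 e, sign e & hgt h x (y + e) = hgt h x y + 1.
Proof.
move=> hh nf xy; apply: contrapT => nex; apply: nf.
apply: (@vertical_crossing_flip _ x y) => e se.
have [E|[]//] := height_edge _ _ hh _ _ (even_edge _ _ _ se xy).
by case: nex; exists e.
Qed.

Lemma noflip_odd (t : set domino) (h : latpt -> int) (x y : int) :
  height_function t h -> ~ admits_flip R t -> ~~ (2 %| x + y)%Z ->
  exists2 e, sign e & hgt h (x + e) y = hgt h x y + 1.
Proof.
move=> hh nf xy; apply: contrapT => nex; apply: nf.
apply: (@horizontal_crossing_flip _ x y) => e se.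
have [E|[]//] := height_edge _ _ hh _ _ (odd_edge _ _ _ se xy).
by case: nex; exists e.
Qed.

Lemma noflip_diag_step (t : set domino) (h : latpt -> int) (x y : int) :
  height_function t h -> ~ admits_flip R t -> (2 %| x + y)%Z ->
  exists a b, [/\ sign a, sign b & hgt h (x + a) (y + b) = hgt h x y + 2].
Proof.
move=> hh nf xy; have [b sb Eb] := noflip_even _ _ _ _ hh nf xy.
have xyb : ~~ (2 %| x + (y + b))%Z by case: sb; lia.
have [a sa Ea] := noflip_odd _ _ _ _ hh nf xyb.
by exists a, b; split => //; lia.
Qed.

Lemma noflip_path (t : set domino) (h : latpt -> int) :
  height_function t h -> ~ admits_flip R t ->
  exists X Y : nat -> int, forall i k : nat,
    [/\ `|X (i + k)%N - X i| <= k%:Z, `|Y (i + k)%N - Y i| <= k%:Z &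
        hgt h (X (i + k)%N) (Y (i + k)%N) = hgt h (X i) (Y i) + 2 * k%:Z].
Proof.
move=> hh nf.
(* The successor must be total for [choice], but only even points matter: the path starts at the
   origin and diagonal steps preserve the parity of the coordinate sum. *)
have /choice[F HF] (u : int * int) : exists w : int * int,
    (2 %| u.1 + u.2)%Z -> [/\ sign (w.1 - u.1), sign (w.2 - u.2) &
      hgt h w.1 w.2 = hgt h u.1 u.2 + 2].
  have [ev|] := boolP (2 %| u.1 + u.2)%Z; last by exists u.
  have [a [b [sa sb E]]] := noflip_diag_step _ _ _ _ hh nf ev.
  by exists (u.1 + a, u.2 + b) => _ /=; split => //; rewrite addrC addKr.
pose p n := iter n F (0, 0).
have ev n : (2 %| (p n).1 + (p n).2)%Z.
  elim: n => // n IH; have [] := HF _ IH; rewrite -[F _]/(p n.+1).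
  by move: IH; rewrite /sign; lia.
exists (fun n => (p n).1), (fun n => (p n).2) => i; elim=> [|k [IH1 IH2 IH3]].
  by rewrite addn0 !subrr !normr0; split; lia.
rewrite addnS; have [] := HF _ (ev (i + k)%N); rewrite -[F _]/(p (i + k).+1).
by rewrite /sign => *; split; lia.
Qed.

End Geometry.

(** * Congruent positions and multiples in the lattice *)

Lemma congruent_pair (D : int) (X Y : nat -> int) : D != 0 ->
  exists i k : nat, [/\ (0 < k)%N, (D %| X (i + k)%N - X i)%Z
                      & (D %| Y (i + k)%N - Y i)%Z].
Proof.
move=> D0; set d := `|D|%N.-1.
pose r (x : int) : 'I_d.+1 := inord `|(x %% D)%Z|%N.
have rE x y : r x = r y -> (D %| x - y)%Z.
  have lt z : (`|(z %% D)%Z| < d.+1)%N.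
    by have := modz_ge0 z D0; have := ltz_mod z D0; lia.
  move=> /(congr1 val); rewrite /= !inordK // => E.
  rewrite -eqz_mod_dvd; apply/eqP.
  by have := modz_ge0 x D0; have := modz_ge0 y D0; lia.
(* Pigeonhole: there are [d.+1 * d.+1] pairs of residues, since [d.+1] is the absolute value of [D],
   and one more index than pairs. *)
pose f (i : 'I_(d.+1 * d.+1).+1) := (r (X i), r (Y i)).
have /injectivePn[i [j neq [EX EY]]] : ~~ injectiveb f.
  by apply/negP => /injectiveP /leq_card; rewrite card_prod !card_ord ltnn.
wlog ij : i j neq EX EY / (i < j)%N.
  move=> W; have [ij|ji|/val_inj E] := ltngtP i j; first exact: (W i j).
    by apply: (W j i) => //; rewrite eq_sym.
  by rewrite E eqxx in neq.
exists i, (j - i)%N; rewrite subn_gt0 (subnKC (ltnW ij)).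
by split; [|exact: rE|exact: rE].
Qed.

Lemma valid_lattice_multiples (L : set latpt) : valid_lattice L ->
  exists2 D : int, D != 0 &
    forall x y, (D %| x)%Z -> (D %| y)%Z -> L (x, y).
Proof.
move=> [[a1 a2] [[b1 b2] [_ _ indep ->]]].
have E m n : (a1, a2) *~ m + (b1, b2) *~ n =
    (a1 * m + b1 * n, a2 * m + b2 * n) :> latpt.
  by rewrite [LHS]surjective_pairing /= !(raddfMz fst, raddfMz snd) /= !mulrzz.
(* The determinant of the two generators. *)
exists (a1 * b2 - a2 * b1).
  apply/negP => /eqP D0.
  (* With zero determinant, these two relations between the generators force all four coordinates to
     vanish, and then the sum of the generators is a forbidden relation. *)
  have [|b20 na20] := indep b2 (- a2); first by rewrite E; congr pair => /=; lia.
  have [|b10 na10] := indep b1 (- a1); first by rewrite E; congr pair => /=; lia.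
  have [] := indep 1 1; last by [].
  by rewrite E; congr pair; lia.
move=> x y /dvdzP[q ->] /dvdzP[r ->].
(* Cramer's rule, with the division by the determinant already carried out. *)
exists (q * b2 - r * b1), (r * a1 - q * a2).
by rewrite E; congr pair; ring.
Qed.

Lemma intr_muln (R : realType) (a : int) (n : nat) :
  (a *+ n)%:~R = a%:~R * n%:R :> R.
Proof. by rewrite rmorphMn mulr_natr. Qed.

(** * Bounds on the flux *)

Section Flux.
Variables (R : realType) (L : set latpt) (t : set domino) (phi : R * R).
Variable h : latpt -> int.
Hypotheses (hL : valid_lattice L) (hh : height_function t h).
Hypothesis hphi : forall u v : latpt, L v ->
  4 * (phi.1 * v.1%:~R + phi.2 * v.2%:~R) = (h (u + v) - h u)%:~R.

Lemma flux_hgt (x y p q : int) : L (p, q) ->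
  4 * (phi.1 * p%:~R + phi.2 * q%:~R) = (hgt h (x + p) (y + q) - hgt h x y)%:~R.
Proof. exact: (hphi (x, y) (p, q)). Qed.

Lemma lattice_diagonal : exists2 n : nat, (2 <= n)%N &
  forall a b : int, L (a *+ n, b *+ n).
Proof.
have [D D0 HL] := valid_lattice_multiples _ hL.
(* The factor 2 provides the two steps required by [height_extremum_lt]. *)
exists (2 * `|D|)%N; first by lia.
by move=> a b; apply: HL;
  rewrite -mulr_natr mulnC natrM mulrA dvdz_mulr // dvdz_mull // natz dvdzE.
Qed.

Lemma flux_diag_le (a b : int) : sign a -> sign b ->
  phi.1 * a%:~R + phi.2 * b%:~R <= 1 / 2.
Proof.
move=> sa sb; have [n n2 Ln] := lattice_diagonal.
have := flux_hgt 0 0 _ _ (Ln a b).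
have := height_diag_iter_le _ _ hh 0 0 _ _ n sa sb.
rewrite -(ler_int R) => le E.
have n0 : 0 < n%:R :> R by rewrite ltr0n; lia.
rewrite -(ler_pM2r n0); move: le E.
rewrite !intr_muln intrB intrD intrM -(pmulrn _ n); lra.
Qed.

(** The flux can be read from any base point, so the diagonal is started one step before the
    extremum. *)
Lemma flux_diag_lt (x y a b : int) : diag_extremum h x y -> sign a -> sign b ->
  phi.1 * a%:~R + phi.2 * b%:~R < 1 / 2.
Proof.
move=> ext sa sb; have [n n2 Ln] := lattice_diagonal.
have := flux_hgt (x - a) (y - b) _ _ (Ln a b).
have := height_extremum_lt _ _ hh _ _ _ _ n ext sa sb n2.
rewrite -(ltr_int R) => lt E.
have n0 : 0 < n%:R :> R by rewrite ltr0n; lia.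
rewrite -(ltr_pM2r n0); move: lt E.
rewrite !intr_muln intrB intrD intrM -(pmulrn _ n); lra.
Qed.

(** The norm is the largest of the four pairings of [phi] with the vectors of coordinates 1 or
    -1. *)
Lemma flux_norm_le : `|phi.1| + `|phi.2| <= 1 / 2.
Proof.
have l : sign 1 by left. have r : sign (- 1) by right.
have := flux_diag_le _ _ l l; have := flux_diag_le _ _ l r.
have := flux_diag_le _ _ r l; have := flux_diag_le _ _ r r.
by rewrite !mulrNz !mulr1z; case: (ger0P phi.1); case: (ger0P phi.2); lra.
Qed.

Lemma flux_norm_lt : admits_flip R t -> `|phi.1| + `|phi.2| < 1 / 2.
Proof.
move=> /(flip_extremum _ _ _ hh)[x [y ext]].
have l : sign 1 by left. have r : sign (- 1) by right.
have := flux_diag_lt _ _ _ _ ext l l; have := flux_diag_lt _ _ _ _ ext l r.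
have := flux_diag_lt _ _ _ _ ext r l; have := flux_diag_lt _ _ _ _ ext r r.
by rewrite !mulrNz !mulr1z; case: (ger0P phi.1); case: (ger0P phi.2); lra.
Qed.

Lemma flux_norm_ge : ~ admits_flip R t -> 1 / 2 <= `|phi.1| + `|phi.2|.
Proof.
move=> nf; have [X [Y path]] := noflip_path _ _ _ hh nf.
have [D D0 HL] := valid_lattice_multiples _ hL.
have [i [k [k0 DX DY]]] := congruent_pair D X Y D0.
have [] := path i k; set p := X (i + k)%N - X i; set q := Y (i + k)%N - Y i.
move=> lep leq E.
have := flux_hgt (X i) (Y i) _ _ (HL _ _ DX DY).
have -> : X i + p = X (i + k)%N by rewrite addrCA subrr addr0.
have -> : Y i + q = Y (i + k)%N by rewrite addrCA subrr addr0.
rewrite -/p -/q E addrAC subrr add0r intrM -(pmulrn _ k) => Ek.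
have k0R : 0 < k%:R :> R by rewrite ltr0n.
(* Applied to both coordinates, this bounds the pairing of [phi] with [(p, q)], which equals
   [k / 2], by [k] times the norm of [phi]. *)
have bound (z : R) (m : int) : `|m| <= k%:Z -> z * m%:~R <= `|z| * k%:R.
  move=> lem; apply: (le_trans (ler_norm _)); rewrite normrM ler_wpM2l //.
  by rewrite -intr_norm pmulrn ler_int.
have := bound phi.1 p lep; have := bound phi.2 q leq.
by rewrite -(ler_pM2r k0R); move: Ek; lra.
Qed.

End Flux.

(** * The boundary of the square [Q] *)

Lemma boundary_Q (R : realType) (z : R * R) :
  boundary (Q R) z <-> `|z.1| + `|z.2| = 1 / 2.
Proof.
have cont : continuous (fun z : R * R => `|z.1| + `|z.2|).
  move=> w; apply: cvgD; apply: continuous_comp; try exact: norm_continuous.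
    exact: cvg_fst.
  exact: cvg_snd.
have clQ : closed (Q R).
  have -> : Q R = (fun z : R * R => `|z.1| + `|z.2|) @^-1` [set x | x <= 1 / 2] by [].
  by apply: preimage_closed => //; exact: closed_le.
rewrite /boundary -(closure_id _).1 //; split.
  move=> [Qz nint]; apply/eqP; rewrite eq_le; apply/andP; split=> //.
  rewrite leNgt; apply/negP => lt; apply: nint.
  have op : open [set w : R * R | `|w.1| + `|w.2| < 1 / 2].
    have := @open_comp _ _ (fun w : R * R => `|w.1| + `|w.2|) [set x | x < 1 / 2].
    by apply; [move=> w _; exact: cont|exact: open_lt].
  have : nbhs z [set w : R * R | `|w.1| + `|w.2| < 1 / 2] by apply: open_nbhs_nbhs.
  by apply: filterS => w /ltW.
move=> E; split; first by rewrite /Q /= E.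
move=> /nbhs_ballP[e /= e0 sub].
(* A sign taking the value 1 at 0, so that moving by [s x * (e / 2)] increases the absolute value
   even at 0. Moving both coordinates this way stays in the ball of radius [e] but leaves [Q]. *)
pose s (x : R) := if 0 <= x then 1 else -1 : R.
have sx (x : R) : `|x + s x * (e / 2)| = `|x| + e / 2.
  rewrite /s; case: ger0P => x0; first by rewrite mul1r ger0_norm //; lra.
  by rewrite ltr0_norm; lra.
have : Q R (z.1 + s z.1 * (e / 2), z.2 + s z.2 * (e / 2)).
  apply: sub; split; rewrite /ball /= opprD addrA subrr sub0r normrN normrM;
    rewrite (ger0_norm (_ : 0 <= e / 2)); try lra.
    by rewrite /s; case: ifP => _; rewrite ?normrN normr1; lra.
  by rewrite /s; case: ifP => _; rewrite ?normrN normr1; lra.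
by rewrite /Q /= !sx; lra.
Qed.

Theorem proposition6p2p2 (R : realType) (L : set latpt) (t : set domino)
    (phi : R * R) (hL : valid_lattice L) (ht : torus_tiling R L t)
    (hphi : is_flux L t phi) :
  (~ admits_flip R t <-> boundary (Q R) phi) /\
  (~ admits_flip R t <-> `|phi.1| + `|phi.2| = 1 / 2).
Proof.
rewrite (boundary_Q R phi).
suff H : ~ admits_flip R t <-> `|phi.1| + `|phi.2| = 1 / 2 by [].
have [h hh fl] := hphi; split.
  move=> nf; apply/eqP; rewrite eq_le (flux_norm_le _ _ _ _ _ hL hh fl).
  exact: flux_norm_ge hL hh fl nf.
by move=> E /(flux_norm_lt _ _ _ _ _ hL hh fl); rewrite E ltxx.
Qed.
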